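(* Let $N\ge1$, $L,R>0$, $\gamma\in[0,L\sqrt N]$, $\sigma=\gamma/L$. Let $\nu\in[0,1]$ be the unique solution of $$\sum_{k=0}^{N-1}\frac{(N-k)\nu^2}{1+(N-(k+1))\nu}=\sigma^2,$$ and set $\ell_N(\sigma)=\sqrt{1+N\nu}$. For any optimization algorithm satisfying the cone condition there exists a problem instance (a finite-dimensional Euclidean space $X$, $x_0\in X$, $f\in\mathcal F$, subgradients $g_k\in\partial f(x_k)$ and errors $e_0,\dots,e_{N-1}$ with $\sum_{i=0}^{N-1}\|e_i\|^2\le\gamma^2$) for which the algorithm's output $x_{N+1}$ satisfies $$f(x_{N+1})-f_\star\ge\frac{RL}{\sqrt{N+1}}\cdot\ell_N(\sigma).$$
   Context: Given $X$ and $x_0\in X$, $\mathcal F$ is the class of convex $f:X\to\mathbb R$ all of whose subgradients (at all points) have norm at most $L$ and which attain their minimum $f_\star=f(x_\star)$ at some $x_\star$ with $\|x_\star-x_0\|\le R$. An optimization algorithm starts from $x_0$ and at each step $k=0,\dots,N-1$ receives a corrupted subgradient $\tilde g_k=g_k+e_k$ with $g_k\in\partial f(x_k)$ and $e_k$ chosen by an adversary; from the information received so far it chooses the next iterate, and after receiving $\tilde g_0,\dots,\tilde g_{N-1}$ it chooses $x_N$ and the output $x_{N+1}$. It satisfies the cone condition if always $$x_k\in x_0-\mathrm{cone}(\tilde g_0,\dots,\tilde g_{k-1})\ \ (k=1,\dots,N),\qquad x_{N+1}\in x_0-\mathrm{cone}(\tilde g_0,\dots,\tilde g_{N-1}),$$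 where $\mathrm{cone}$ denotes the set of nonnegative linear combinations. The dimension of $X$ is not fixed in advance: the algorithm is defined for every finite-dimensional Euclidean space. *)

(* Defs.v *)
From HB Require Import structures.
From mathcomp Require Import all_boot all_order all_algebra.
From mathcomp Require Import all_classical all_reals convex.
Set Implicit Arguments.
Unset Strict Implicit.
Unset Printing Implicit Defensive.
Import Order.TTheory GRing.Theory Num.Theory.
Local Open Scope classical_set_scope.
Local Open Scope ring_scope.

(* Euclidean space of dimension d is 'rV[R]_d with the standard inner product;
   the library norm `|u| on row vectors is the sup norm, hence enorm. *)
Definition dotp (R : realType) (d : nat) (u v : 'rV[R]_d) : R :=
  \sum_(i < d) u 0 i * v 0 i.

Definition enorm (R : realType) (d : nat) (u : 'rV[R]_d) : R :=
  Num.sqrt (dotp u u).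

Definition subdifferential (R : realType) (d : nat) (f : 'rV[R]_d -> R)
    (x : 'rV[R]_d) : set 'rV[R]_d :=
  [set g | forall y, f x + dotp g (y - x) <= f y].

Definition is_minimizer (R : realType) (d : nat) (f : 'rV[R]_d -> R)
    (xs : 'rV[R]_d) : Prop := forall y, f xs <= f y.

Definition function_class (R : realType) (L rad : R) (d : nat)
    (x0 : 'rV[R]_d) : set ('rV[R]_d -> R) :=
  [set f | [/\ convex_function [set: 'rV[R]_d] f,
               forall x g, subdifferential f x g -> enorm g <= L
             & exists2 xs, is_minimizer f xs & enorm (xs - x0) <= rad]].

Definition cone (R : realType) (d : nat) (s : seq 'rV[R]_d) :
    set 'rV[R]_d :=
  [set v | exists2 c : 'I_(size s) -> R,
     forall i, 0 <= c i & v = \sum_(i < size s) c i *: s`_i].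

(* An algorithm is defined in every dimension at once.  In both fields the
   arguments are the starting point x_0 and the list of corrupted subgradients
   received so far, oldest first; the x_k are functions of these. *)
Record algorithm (R : realType) := Algorithm {
  next_iterate : forall d : nat, 'rV[R]_d -> seq 'rV[R]_d -> 'rV[R]_d;
  final_output : forall d : nat, 'rV[R]_d -> seq 'rV[R]_d -> 'rV[R]_d
}.

(* corrupted g e k = [:: g_0 + e_0; ...; g_(k-1) + e_(k-1)] *)
Definition corrupted (R : realType) (d : nat) (g e : nat -> 'rV[R]_d)
    (k : nat) : seq 'rV[R]_d := mkseq (fun i => g i + e i) k.

(* x is the trajectory of A on the instance (x0, f, g, e), which is required to
   be admissible (f in the class, errors within the budget).  Only the values
   x_0, ..., x_(N+1), g_0, ..., g_(N-1) and e_0, ..., e_(N-1) are relevant. *)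
Record admissible_run (R : realType) (N : nat) (L rad gamma : R)
    (A : algorithm R) (d : nat) (x0 : 'rV[R]_d) (f : 'rV[R]_d -> R)
    (g e x : nat -> 'rV[R]_d) : Prop := AdmissibleRun {
  run_class : function_class L rad x0 f;
  run_start : x 0%N = x0;
  run_next : forall k, (0 < k <= N)%N ->
    x k = next_iterate A x0 (corrupted g e k);
  run_output : x N.+1 = final_output A x0 (corrupted g e N);
  run_subgradient : forall k, (k < N)%N -> subdifferential f (x k) (g k);
  run_budget : \sum_(i < N) enorm (e i) ^+ 2 <= gamma ^+ 2
}.

(* Required only along the runs that can actually occur, not for arbitrary
   lists of vectors. *)
Definition cone_condition (R : realType) (N : nat) (L rad gamma : R)
    (A : algorithm R) : Prop :=
  forall (d : nat) (x0 : 'rV[R]_d) (f : 'rV[R]_d -> R)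
    (g e x : nat -> 'rV[R]_d),
  admissible_run N L rad gamma A x0 f g e x ->
  (forall k, (0 < k <= N)%N ->
     [set x0 - v | v in cone (corrupted g e k)] (x k))
  /\ [set x0 - v | v in cone (corrupted g e N)] (x N.+1).

Definition nu_solution (R : realType) (N : nat) (sigma nu : R) : Prop :=
  0 <= nu <= 1 /\
  \sum_(0 <= k < N) (N - k)%N%:R * nu ^+ 2 / (1 + (N - k.+1)%N%:R * nu)
    = sigma ^+ 2.

Definition ell (R : realType) (N : nat) (nu : R) : R :=
  Num.sqrt (1 + N%:R * nu).

(* Main.v *)
Require Import Defs.
From HB Require Import structures.
From mathcomp Require Import all_boot all_order all_algebra.
From mathcomp Require Import all_classical all_reals convex.
From mathcomp Require Import interval_inference topology normedtype ring lra.
Set Implicit Arguments.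
Unset Strict Implicit.
Unset Printing Implicit Defensive.
Import Order.TTheory GRing.Theory Num.Theory.
Import numFieldNormedType.Exports.
Local Open Scope classical_set_scope.
Local Open Scope ring_scope.

(** The adversary plays a piecewise linear function whose pieces are
    equicorrelated.  Take unit vectors [v_0, ..., v_N] with all mutual products
    equal to [nu], put [x_0 = 0] and
      [f x = max (max_j L <v_j, x>) (- gap)].
    The vector of the convex hull of the [v_j] closest to the origin is their
    mean, whose squared norm is [(1 + N nu) / (N + 1)].  Hence on the ball of
    radius [rad] the inner maximum goes down to [- gap] with
    [gap = rad L sqrt ((1 + N nu) / (N + 1))], and the constant piece merely
    stops [f] at this value, so that the minimum is attained within reach
    ([hard_minimizerP]).

    It remains to keep the algorithm at height 0.  At step [k] the adversary
    returns [g_k = L v_k], corrupted so that what the algorithm sees is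
    [L (v_k - projection of v_k on span (v_{k+1}, ..., v_N))].  This vector is
    orthogonal to all later [v_j] and, because [0 <= nu <= 1], has nonnegative
    product with [v_j] for [j <= k].  Therefore at any point of minus the cone
    of the first [k] such vectors, the pieces [k, ..., N] vanish and the others
    are nonpositive: piece [k] is active, so that [L v_k] is a genuine
    subgradient there, and [f = 0] ([hard_function_on_cone]).  The output lies
    in such a cone too, so it is at distance [gap] from the optimum.  The
    squared length of the [k]-th error is
    [L^2 (N - k) nu^2 / (1 + (N - k - 1) nu)] ([sqr_enorm_error]), and the
    equation that defines [nu] says that these add up to [gamma^2].

    The cone condition speaks only about complete admissible runs, whereas
    [L v_k] is admissible only once [x_k] is known to lie in the cone.  The
    adversary is therefore adaptive: it follows the script while piece [k] is
    active, and otherwise returns an honest subgradient without error.  Its run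
    is admissible against every algorithm ([resisting_run]); the cone condition
    then applies to it, and shows by induction on [k] that the script is never
    left ([resisting_output]).

    Existence and uniqueness of [nu] hold because the left-hand side of the
    equation is continuous and strictly increasing on [[0, 1]], from 0 to [N]
    ([nu_solution_unique]). *)

(** * The Euclidean inner product *)

Section EuclideanProduct.
Variables (R : realType) (d : nat).
Implicit Types (u v w x : 'rV[R]_d) (a : R).

Lemma dotpC u v : dotp u v = dotp v u.
Proof. by apply: eq_bigr => i _; rewrite mulrC. Qed.

Lemma dotpDl u v w : dotp (u + v) w = dotp u w + dotp v w.
Proof. by rewrite -big_split; apply: eq_bigr => i _; rewrite mxE mulrDl. Qed.

Lemma dotpZl a u w : dotp (a *: u) w = a * dotp u w.
Proof. by rewrite mulr_sumr; apply: eq_bigr => i _; rewrite mxE mulrA. Qed.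

Lemma dotpDr u v w : dotp w (u + v) = dotp w u + dotp w v.
Proof. by rewrite dotpC dotpDl !(dotpC w). Qed.

Lemma dotpZr a u w : dotp w (a *: u) = a * dotp w u.
Proof. by rewrite dotpC dotpZl dotpC. Qed.

Lemma dotpNr u w : dotp w (- u) = - dotp w u.
Proof. by rewrite -scaleN1r dotpZr mulN1r. Qed.

Lemma dotpBr u v w : dotp w (u - v) = dotp w u - dotp w v.
Proof. by rewrite dotpDr dotpNr. Qed.

Lemma dotp0l w : dotp 0 w = 0.
Proof. by rewrite -(scale0r 0) dotpZl mul0r. Qed.

Lemma dotp0r w : dotp w 0 = 0.
Proof. by rewrite dotpC dotp0l. Qed.

Lemma dotp_sumr (I : Type) (r : seq I) (P : pred I) (F : I -> 'rV[R]_d) w :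
  dotp w (\sum_(i <- r | P i) F i) = \sum_(i <- r | P i) dotp w (F i).
Proof. by apply: big_morph; [move=> u v; exact: dotpDr | exact: dotp0r]. Qed.

Lemma dotpp_ge0 u : 0 <= dotp u u.
Proof. by apply: sumr_ge0 => i _; rewrite -expr2 sqr_ge0. Qed.

Lemma sqr_enorm u : enorm u ^+ 2 = dotp u u.
Proof. by rewrite sqr_sqrtr // dotpp_ge0. Qed.

Lemma enorm_le u a : 0 <= a -> (enorm u <= a) = (dotp u u <= a ^+ 2).
Proof. by move=> a0; rewrite -sqr_enorm ler_sqr // nnegrE sqrtr_ge0. Qed.

Lemma dotp_delta (i j : 'I_d) :
  dotp (delta_mx 0 i : 'rV[R]_d) (delta_mx 0 j) = (i == j)%:R.
Proof.
rewrite /dotp (bigD1 i) //= !mxE !eqxx mul1r big1 ?addr0 // => k /negPf ki.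
by rewrite !mxE ki mul0r.
Qed.

End EuclideanProduct.

(** * Maxima of finitely many affine functions *)

Section MaxAffine.
Variables (R : realType) (d : nat) (I : finType) (i0 : I).
Variables (u : I -> 'rV[R]_d) (b : I -> R).
Implicit Types x y : 'rV[R]_d.

Definition piece i x : R := dotp (u i) x + b i.
Definition active_piece x : I := [arg max_(i > i0) piece i x]%O.
Definition max_affine x : R := piece (active_piece x) x.

Lemma piece_le_max i x : piece i x <= max_affine x.
Proof.
by rewrite /max_affine /active_piece; case: arg_maxP => // j _; apply.
Qed.

Lemma max_affine_convex : convex_function [set: 'rV[R]_d] max_affine.
Proof.
move=> t x y _ _; rewrite convRE {1}/max_affine.
set i := active_piece _.
have -> : piece i (conv t x y) =
    t%:num * piece i x + (1 - t%:num) * piece i y.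
  by rewrite /piece /conv /= /unstable.onem dotpDr !dotpZr; ring.
have t0 : 0 <= t%:num by exact: ge0.
have t1 : t%:num <= 1 by exact: le1.
by rewrite lerD // ler_wpM2l ?piece_le_max // subr_ge0.
Qed.

Lemma active_subgradient i x :
  piece i x = max_affine x -> subdifferential max_affine x (u i).
Proof.
move=> ix y; rewrite -ix; apply: le_trans (piece_le_max i y).
by rewrite /piece dotpBr; lra.
Qed.

(** At [x + g] some piece [i] is active; the subgradient inequality there and
    [piece i x <= max_affine x] give [dotp g g <= dotp (u i) g].  Expanding
    [0 <= dotp (g - u i) (g - u i)] then yields [dotp g g <= dotp (u i) (u i)],
    which replaces an appeal to Cauchy-Schwarz. *)
Lemma max_affine_subgradient_bound (L : R) x g :
  (forall i, enorm (u i) <= L) ->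
  subdifferential max_affine x g -> enorm g <= L.
Proof.
move=> uL /(_ (x + g)); rewrite [_ + g - _]addrAC subrr add0r {2}/max_affine.
set i := active_piece _ => sub.
have L0 : 0 <= L by exact: le_trans (sqrtr_ge0 _) (uL i).
have := uL i; rewrite !enorm_le //; apply: le_trans.
have := piece_le_max i x; rewrite /piece in sub * => pi.
have := dotpp_ge0 (g - u i).
rewrite dotpBr [dotp (g - u i) g]dotpC [dotp (g - u i) (u i)]dotpC.
rewrite !dotpBr (dotpC g (u i)).
by move: sub; rewrite dotpDr; lra.
Qed.

End MaxAffine.

(** * Equicorrelated unit vectors *)

Section Equicorrelated.
Variables (R : realType) (N : nat) (nu : R).
Hypothesis nu01 : 0 <= nu <= 1.

(** One private coordinate for each vector and a last coordinate shared by all: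
    the shared part alone contributes to mutual products.  For [nu = 1] all the
    vectors coincide, which the argument tolerates. *)
Definition equicorr (k : nat) : 'rV[R]_N.+2 :=
  Num.sqrt (1 - nu) *: delta_mx 0 (inord k) + Num.sqrt nu *: delta_mx 0 ord_max.

Lemma dotp_equicorr i j : (i <= N)%N -> (j <= N)%N ->
  dotp (equicorr i) (equicorr j) = nu + (1 - nu) * (i == j)%:R.
Proof.
case/andP: nu01 => nu0 nu1 iN jN.
have ne k : (k <= N)%N -> (@inord N.+1 k == ord_max) = false.
  by move=> kN; rewrite -val_eqE /= inordK ?ltn_eqF // ltnS leqW.
rewrite !dotpDl !dotpDr !dotpZl !dotpZr !dotp_delta eqxx [ord_max == _]eq_sym.
rewrite !ne // -val_eqE /= !inordK ?ltnS ?leqW // !mulr0 addr0 add0r mulr1.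
have e1 : 0 <= 1 - nu by lra.
by rewrite mulrA -!expr2 !sqr_sqrtr // addrC.
Qed.

Definition tail_sum (m : nat) : 'rV[R]_N.+2 := \sum_(m <= l < N.+1) equicorr l.

Lemma dotp_tail_sum j m : (j <= N)%N -> (m <= N.+1)%N ->
  dotp (equicorr j) (tail_sum m) =
    (N.+1 - m)%:R * nu + (1 - nu) * (m <= j)%:R.
Proof.
move=> jN mN; rewrite /tail_sum dotp_sumr big_nat.
under eq_bigr => l /andP[_ lN] do rewrite dotp_equicorr //.
rewrite -big_nat big_split /= sumr_const_nat -[nu *+ _]mulr_natl -mulr_sumr.
congr (_ + _ * _).
case: (leqP m j) => mj /=; last first.
  rewrite big_nat big1 // => l /andP[ml _].
  by rewrite (ltn_eqF (leq_trans mj ml)).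
rewrite (big_cat_nat _ (n := j)) //=; last by rewrite leqW.
rewrite big_nat big1 ?add0r; last by move=> l /andP[_ lj]; rewrite gtn_eqF.
rewrite big_ltn ?ltnS // eqxx big_nat big1 ?addr0 // => l /andP[jl _].
by rewrite ltn_eqF.
Qed.

Lemma dotpp_tail_sum m : (m <= N.+1)%N ->
  dotp (tail_sum m) (tail_sum m) =
    (N.+1 - m)%:R * (1 - nu + (N.+1 - m)%:R * nu).
Proof.
move=> mN; rewrite {2}/tail_sum dotp_sumr big_nat.
under eq_bigr => l /andP[ml lN] do rewrite dotpC dotp_tail_sum // ml mulr1.
by rewrite -big_nat sumr_const_nat -[LHS]mulr_natl addrC.
Qed.

(** The projection of [equicorr i] on the span of the later vectors is, by
    symmetry, a multiple of their sum; this is the multiplier. *)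
Definition residual_coef (i : nat) : R := nu / (1 + (N - i.+1)%:R * nu).

Definition residual (i : nat) : 'rV[R]_N.+2 :=
  equicorr i - residual_coef i *: tail_sum i.+1.

Lemma residual_denom_gt0 m : 0 < 1 + m%:R * nu.
Proof. by case/andP: nu01 => nu0 _; rewrite ltr_pwDl // mulr_ge0. Qed.

Lemma natr_sub_split i : (i < N)%N -> (N.+1 - i.+1)%:R = 1 + (N - i.+1)%:R :> R.
Proof. by move=> iN; rewrite subSS nat1r -subSn. Qed.

Lemma dotp_residual_later i j : (i < j <= N)%N ->
  dotp (equicorr j) (residual i) = 0.
Proof.
move=> /andP[ij jN]; have iN := leq_trans ij jN.
have := residual_denom_gt0 (N - i.+1).
rewrite /residual dotpBr dotpZr dotp_tail_sum ?leqW // dotp_equicorr ?(ltnW iN) //.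
rewrite ij gtn_eqF // mulr0 mulr1 natr_sub_split // /residual_coef.
by move: (N - i.+1)%:R => m /lt0r_neq0 D0; field.
Qed.

(** With [m] the number of vectors after [i.+1], the product factors as
    [(1 - nu) (nu / (1 + m nu) + [j = i])], so the bound [nu <= 1] is what makes
    it nonnegative. *)
Lemma dotp_residual_earlier i j : (i < N)%N -> (j <= i)%N ->
  0 <= dotp (equicorr j) (residual i).
Proof.
move=> iN ji; case/andP: nu01 => nu0 nu1.
have D0 := residual_denom_gt0 (N - i.+1).
have iN' := ltnW iN.
rewrite /residual dotpBr dotpZr dotp_tail_sum ?leqW ?(leq_trans ji) //.
rewrite dotp_equicorr ?(leq_trans ji) // ltnNge ji mulr0 addr0 natr_sub_split //.
rewrite /residual_coef; move: (N - i.+1)%:R D0 => m D0.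
have -> : nu + (1 - nu) * (j == i)%:R - nu / (1 + m * nu) * ((1 + m) * nu) =
    (1 - nu) * (nu / (1 + m * nu) + (j == i)%:R).
  by have := lt0r_neq0 D0 => ?; field.
by rewrite mulr_ge0 ?subr_ge0 // addr_ge0 // divr_ge0 // ltW.
Qed.

(** Each summand of the equation for [nu] is the squared length of a projection
    that the adversary has to cancel. *)
Lemma sqr_enorm_error (L : R) i : (i < N)%N ->
  enorm (- (L * residual_coef i) *: tail_sum i.+1) ^+ 2 =
    L ^+ 2 * ((N - i)%:R * nu ^+ 2 / (1 + (N - i.+1)%:R * nu)).
Proof.
move=> iN; rewrite sqr_enorm dotpZl dotpZr (dotpp_tail_sum (leqW iN)).
have := residual_denom_gt0 (N - i.+1).
rewrite -[X in _ * (X%:R * _ / _)]subSS natr_sub_split // /residual_coef.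
by move: (N - i.+1)%:R => m /lt0r_neq0 D0; field.
Qed.

End Equicorrelated.

(** * The equation for nu *)

Section ErrorBudget.
Variables (R : realType) (N : nat).

Definition budget_term (k : nat) (nu : R) : R :=
  (N - k)%N%:R * nu ^+ 2 / (1 + (N - k.+1)%N%:R * nu).

Definition budget (nu : R) : R := \sum_(0 <= k < N) budget_term k nu.

(** After clearing denominators the difference of the two sides is
    [(b - a) (a + b + a b m)], up to the positive factor [N - k]. *)
Lemma budget_term_lt k (a b : R) : (k < N)%N -> 0 <= a -> a < b ->
  budget_term k a < budget_term k b.
Proof.
move=> kN a0 ab; have b0 : 0 <= b by lra.
have c0 : 0 < (N - k)%N%:R :> R by rewrite ltr0n subn_gt0.
rewrite /budget_term; move: (N - k)%N%:R c0 => c c0.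
have m0 : 0 <= (N - k.+1)%N%:R :> R by exact: ler0n.
move: (N - k.+1)%N%:R m0 => m m0.
rewrite ltr_pdivrMr ?ltr_pwDl ?mulr_ge0 // mulrAC.
rewrite ltr_pdivlMr ?ltr_pwDl ?mulr_ge0 // -!mulrA ltr_pM2l // -subr_gt0.
have -> : b * (b * (1 + m * a)) - a * (a * (1 + m * b)) =
    (b - a) * (a + b + a * b * m) by ring.
have abm : 0 <= a * b * m by rewrite !mulr_ge0.
by rewrite mulr_gt0 //; lra.
Qed.

Lemma budget_lt (a b : R) : (0 < N)%N -> 0 <= a -> a < b -> budget a < budget b.
Proof.
by move=> N0 a0 ab; apply: ltr_sum_nat => // k /andP[_ kN]; exact: budget_term_lt.
Qed.

Lemma budget0 : budget 0 = 0.
Proof. by apply: big1 => k _; rewrite /budget_term expr0n mulr0 mul0r. Qed.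

Lemma budget1 : budget 1 = N%:R.
Proof.
rewrite /budget big_nat.
under eq_bigr => k /andP[_ kN].
  rewrite /budget_term expr1n !mulr1 nat1r -subSn // subSS divff; last first.
    by rewrite pnatr_eq0 -lt0n subn_gt0.
  over.
by rewrite -big_nat sumr_const_nat subn0.
Qed.

Lemma budget_continuous (nu : R) : 0 <= nu -> {for nu, continuous budget}.
Proof.
move=> nu0.
suff cont n : {for nu, continuous (fun x => \sum_(0 <= k < n) budget_term k x)}.
  exact: cont.
elim: n => [|n IHn].
  have -> : (fun x => \sum_(0 <= k < 0) budget_term k x) = cst 0.
    by apply/funext => x; rewrite big_geq.
  exact: cst_continuous.
have -> : (fun x => \sum_(0 <= k < n.+1) budget_term k x) =
    (fun x => \sum_(0 <= k < n) budget_term k x) \+ budget_term n.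
  by apply/funext => x; rewrite big_nat_recr.
apply: continuousD => //; rewrite /budget_term.
apply: continuousM.
  apply: continuousM; first exact: cst_continuous.
  by apply: continuousM.
apply: continuousV; first by rewrite lt0r_neq0 // ltr_pwDl // mulr_ge0.
apply: continuousD; first exact: cst_continuous.
by apply: continuousM; first exact: cst_continuous.
Qed.

Lemma nu_solution_unique (sigma : R) : (0 < N)%N -> 0 <= sigma ^+ 2 <= N%:R ->
  exists! nu : R, nu_solution N sigma nu.
Proof.
move=> N0 s2.
have [||nu] := @IVT R budget 0 1 (sigma ^+ 2) ler01.
- apply: continuous_in_subspaceT => x; rewrite inE /= in_itv /= => /andP[x0 _].
  exact: budget_continuous.
- by rewrite budget0 budget1 min_l // max_r.
rewrite in_itv /= => nu01 nuE; exists nu; split; first by [].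
move=> mu [/andP[mu0 mu1] muE]; case/andP: nu01 => nu0 nu1.
case: (ltgtP nu mu) => // lt.
- by have := budget_lt N0 nu0 lt; rewrite nuE /budget muE ltxx.
- by have := budget_lt N0 mu0 lt; rewrite nuE /budget muE ltxx.
Qed.

End ErrorBudget.

(** * Running an algorithm against an adaptive adversary *)

Section Interaction.
Variables (R : realType) (A : algorithm R) (d : nat) (x0 : 'rV[R]_d).
Variables (reply error : nat -> 'rV[R]_d -> 'rV[R]_d).

Definition query (k : nat) (s : seq 'rV[R]_d) : 'rV[R]_d :=
  if k is 0 then x0 else next_iterate A x0 s.

(** The points queried and the vectors received depend on each other; recursion
    on the list of received vectors unties the knot, as every query is a
    function of that list. *)
Fixpoint transcript (k : nat) : seq 'rV[R]_d :=
  if k is k'.+1 then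
    let s := transcript k' in
    let x := query k' s in rcons s (reply k' x + error k' x)
  else [::].

Definition visited (k : nat) : 'rV[R]_d := query k (transcript k).

Definition trajectory (N k : nat) : 'rV[R]_d :=
  if k == N.+1 then final_output A x0 (transcript N) else visited k.

Lemma corrupted_transcript k :
  corrupted (fun i => reply i (visited i)) (fun i => error i (visited i)) k
  = transcript k.
Proof. by elim: k => [|k IHk] //; rewrite /corrupted mkseqS [mkseq _ _]IHk. Qed.

End Interaction.

(** * The resisting adversary *)

Section ResistingInstance.
Variables (R : realType) (N : nat) (L rad gamma nu : R).
Hypotheses (L_gt0 : 0 < L) (rad_gt0 : 0 < rad) (nu01 : 0 <= nu <= 1).

Local Notation V := 'rV[R]_N.+2.
Local Notation v := (equicorr N nu).

Definition gap : R := rad * L / Num.sqrt N.+1%:R * ell N nu.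

(** The index [None] is the constant piece that bounds the function below. *)
Definition slope (i : option 'I_N.+1) : V := if i is Some j then L *: v j else 0.

Definition offset (i : option 'I_N.+1) : R := if i is Some _ then 0 else - gap.

Local Notation hard_piece := (piece slope offset).

Definition hard_function : V -> R := max_affine None slope offset.

Definition scripted_piece (k : nat) : option 'I_N.+1 := Some (inord k).

Definition on_script (k : nat) (x : V) : bool :=
  hard_piece (scripted_piece k) x == hard_function x.

Definition resisting_reply (k : nat) (x : V) : V :=
  slope (if on_script k x then scripted_piece k
         else active_piece None slope offset x).

Definition resisting_error (k : nat) (x : V) : V :=
  if on_script k x then - (L * residual_coef N nu k) *: tail_sum N nu k.+1
  else 0.

Lemma gap_ge0 : 0 <= gap.
Proof. by rewrite /gap !mulr_ge0 ?invr_ge0 ?sqrtr_ge0 // ltW. Qed.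

Lemma enorm_slope i : enorm (slope i) <= L.
Proof.
rewrite (enorm_le _ (ltW L_gt0)); case: i => [j|]; rewrite /slope; last first.
  by rewrite dotp0l sqr_ge0.
rewrite dotpZl dotpZr dotp_equicorr ?leq_ord // eqxx mulr1 addrC subrK mulr1.
by rewrite expr2.
Qed.

Lemma resisting_subgradient k x :
  subdifferential hard_function x (resisting_reply k x).
Proof. by apply: active_subgradient; case: ifP => [/eqP|]. Qed.

Lemma scripted_corrupted k x : (k <= N)%N -> on_script k x ->
  resisting_reply k x + resisting_error k x = L *: residual N nu k.
Proof.
move=> kN on; rewrite /resisting_reply /resisting_error on /= inordK //.
by rewrite scaleNr -scalerA -scalerBr.
Qed.

Lemma hard_piece_scripted k x : (k <= N)%N ->
  hard_piece (scripted_piece k) x = L * dotp (v k) x.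
Proof. by move=> kN; rewrite /piece /= addr0 dotpZl inordK. Qed.

(** Products with the residuals [i < k] vanish for [j >= k] and are nonnegative
    for [j < k]; the sign in front of the cone turns the latter into nonpositive
    pieces, so piece [k] attains the maximum, which is 0. *)
Lemma hard_function_on_cone k (c : 'I_k -> R) x : (k <= N)%N -> (forall i, 0 <= c i) ->
  x = - \sum_(i < k) c i *: (L *: residual N nu i) ->
  hard_piece (scripted_piece k) x = 0 /\ hard_function x = 0.
Proof.
move=> kN c0 ->; set x' := - _.
have vx j : dotp (v j) x' = - \sum_(i < k) c i * (L * dotp (v j) (residual N nu i)).
  rewrite dotpNr dotp_sumr; congr (- _).
  by apply: eq_bigr => i _; rewrite !dotpZr.
have kx0 : hard_piece (scripted_piece k) x' = 0.
  rewrite hard_piece_scripted // vx big1 ?oppr0 ?mulr0 // => i _.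
  by rewrite dotp_residual_later ?mulr0 // ltn_ord.
split=> //; apply/le_anti/andP; split; last by rewrite -kx0 piece_le_max.
rewrite /hard_function /max_affine; case: (active_piece _ _ _ _) => [j|]; last first.
  by rewrite /piece /= dotp0l add0r oppr_le0 gap_ge0.
rewrite /piece /= addr0 dotpZl vx mulrN oppr_le0 mulr_ge0 ?(ltW L_gt0) //.
apply: sumr_ge0 => i _; rewrite !mulr_ge0 ?(ltW L_gt0) //.
have iN := leq_trans (ltn_ord i) kN.
have [ji|ij] := leqP j i; first exact: dotp_residual_earlier.
by rewrite dotp_residual_later // ij -ltnS ltn_ord.
Qed.

Definition hard_minimizer : V :=
  - (rad / (Num.sqrt N.+1%:R * ell N nu)) *: tail_sum N nu 0.

Lemma sqr_ell : ell N nu ^+ 2 = 1 + N%:R * nu.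
Proof. by rewrite sqr_sqrtr // ltW // residual_denom_gt0. Qed.

Lemma ell_gt0 : 0 < ell N nu.
Proof. by rewrite sqrtr_gt0 residual_denom_gt0. Qed.

(** The minimizer points against the mean of the vectors, with which all of
    them have the same product: all nonconstant pieces reach [- gap] together. *)
Lemma hard_minimizerP : is_minimizer hard_function hard_minimizer /\
  hard_function hard_minimizer = - gap.
Proof.
have lower x : - gap <= hard_function x.
  have := piece_le_max None slope offset None x.
  by rewrite {1}/piece /= dotp0l add0r.
suff E : hard_function hard_minimizer = - gap by split=> // y; rewrite E.
apply/le_anti; rewrite lower andbT /hard_function /max_affine.
case: (active_piece _ _ _ _) => [j|]; last by rewrite /piece /= dotp0l add0r.
rewrite /piece /= addr0 dotpZl dotpZr dotp_tail_sum ?leq_ord // subn0 leq0n mulr1.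
have -> : N.+1%:R * nu + (1 - nu) = ell N nu ^+ 2.
  by rewrite sqr_ell -nat1r; ring.
have /lt0r_neq0 := ell_gt0; have : Num.sqrt N.+1%:R != 0 :> R.
  by rewrite gt_eqF // sqrtr_gt0 ltr0n.
rewrite /gap; move: (Num.sqrt _) (ell _ _) => s l s0 l0.
by rewrite le_eqVlt; apply/orP; left; apply/eqP; field; rewrite s0.
Qed.

Lemma enorm_hard_minimizer : enorm (hard_minimizer - 0) <= rad.
Proof.
rewrite subr0 (enorm_le _ (ltW rad_gt0)) dotpZl dotpZr dotpp_tail_sum // subn0.
have -> : 1 - nu + N.+1%:R * nu = ell N nu ^+ 2.
  by rewrite sqr_ell -nat1r; ring.
have s2 : Num.sqrt N.+1%:R ^+ 2 = N.+1%:R :> R by rewrite sqr_sqrtr.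
have /lt0r_neq0 := ell_gt0; have : Num.sqrt N.+1%:R != 0 :> R.
  by rewrite gt_eqF // sqrtr_gt0 ltr0n.
move: (Num.sqrt _) (ell _ _) s2 => s l <- s0 l0.
by rewrite le_eqVlt; apply/orP; left; apply/eqP; field; apply/andP.
Qed.

Variable A : algorithm R.
Local Notation x_ := (trajectory A 0 resisting_reply resisting_error N).
Local Notation y_ := (visited A 0 resisting_reply resisting_error).
Local Notation g_ := (fun k => resisting_reply k (y_ k)).
Local Notation e_ := (fun k => resisting_error k (y_ k)).

(** Off the script the reply is still a subgradient and the error is zero, so
    admissibility needs no knowledge of where the algorithm goes, and the budget
    bound is an inequality. *)
Lemma resisting_run : budget N nu = (gamma / L) ^+ 2 ->
  admissible_run N L rad gamma A 0 hard_function g_ e_ x_.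
Proof.
move=> nuE; split.
- split; [exact: max_affine_convex| |].
    by move=> x g; apply: max_affine_subgradient_bound; exact: enorm_slope.
  exists hard_minimizer; first by have [] := hard_minimizerP.
  exact: enorm_hard_minimizer.
- by [].
- move=> k /andP[k0 kN]; rewrite corrupted_transcript /trajectory ltn_eqF //.
  by case: k k0 kN.
- by rewrite /trajectory eqxx corrupted_transcript.
- move=> k kN; rewrite /trajectory ltn_eqF ?leqW //; exact: resisting_subgradient.
have -> : gamma ^+ 2 = L ^+ 2 * budget N nu.
  by rewrite nuE expr_div_n mulrC divfK // expf_neq0 // gt_eqF.
rewrite /budget big_mkord mulr_sumr; apply: ler_sum => i _.
rewrite /resisting_error; case: ifP => _; first by rewrite sqr_enorm_error.
rewrite sqr_enorm dotp0l mulr_ge0 ?sqr_ge0 // divr_ge0 //.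
  by rewrite mulr_ge0 ?sqr_ge0.
by rewrite ltW // residual_denom_gt0.
Qed.

Lemma hard_function_at_cone_point k z : (k <= N)%N ->
  (forall i, (i < k)%N -> on_script i (y_ i)) ->
  [set 0 - w | w in cone (corrupted g_ e_ k)] z ->
  hard_piece (scripted_piece k) z = 0 /\ hard_function z = 0.
Proof.
move=> kN on [w [c c0 ->] <-].
have sz : k = size (corrupted g_ e_ k) by rewrite size_mkseq.
apply: (hard_function_on_cone (c := fun i => c (cast_ord sz i))) => //.
rewrite sub0r; congr (- _); rewrite (reindex (cast_ord sz)) /=; last first.
  by exists (cast_ord (esym sz)) => i _; rewrite ?cast_ordK ?cast_ordKV.
apply: eq_bigr => i _; rewrite nth_mkseq // scripted_corrupted //.
- by rewrite ltnW // (leq_trans (ltn_ord i)).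
- exact: on.
Qed.

(** Strong induction: as long as the script was followed before step [k], the
    cone condition places [x_k] where piece [k] is active, so step [k] follows
    the script as well.  The output lies in the cone of all [N] vectors, where
    the never revealed piece [N] is zero. *)
Lemma resisting_output : budget N nu = (gamma / L) ^+ 2 ->
  cone_condition N L rad gamma A -> hard_function (x_ N.+1) = 0.
Proof.
move=> /resisting_run run coneA; have [cone_k cone_out] := coneA _ _ _ _ _ _ run.
suff on k : (k < N)%N -> on_script k (y_ k).
  by have [] := hard_function_at_cone_point (leqnn N) on cone_out.
elim/ltn_ind: k => k IHk kN; rewrite /on_script.
have on i : (i < k)%N -> on_script i (y_ i).
  by move=> ik; apply: IHk => //; exact: ltn_trans kN.
have [-> ->] // : hard_piece (scripted_piece k) (y_ k) = 0 /\
    hard_function (y_ k) = 0.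
apply: (hard_function_at_cone_point (ltnW kN) on).
case: k kN {IHk on} => [_|k kN].
  (* The starting point lies in the cone of no vectors. *)
  exists 0; last by rewrite subr0.
  by exists (fun=> 0) => //; rewrite big_ord0.
by have := cone_k k.+1; rewrite /trajectory ltn_eqF ?ltnS ?(ltnW kN) //; apply.
Qed.

End ResistingInstance.

Theorem corollary2 (R : realType) (N : nat) (L rad gamma : R)
  (hN : (1 <= N)%N) (hL : 0 < L) (hrad : 0 < rad)
  (hgamma : 0 <= gamma <= L * Num.sqrt N%:R) :
  (exists! nu : R, nu_solution N (gamma / L) nu) /\
  forall nu : R, nu_solution N (gamma / L) nu ->
  forall A : algorithm R, cone_condition N L rad gamma A ->
  exists (d : nat) (x0 : 'rV[R]_d) (f : 'rV[R]_d -> R)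
    (g e x : nat -> 'rV[R]_d) (xs : 'rV[R]_d),
  [/\ admissible_run N L rad gamma A x0 f g e x,
      is_minimizer f xs
    & f (x N.+1) - f xs >= rad * L / Num.sqrt N.+1%:R * ell N nu].
Proof.
case/andP: hgamma => gamma0 gammaL; split.
  apply: nu_solution_unique => //; rewrite sqr_ge0 /=.
  rewrite -[leRHS]sqr_sqrtr // ler_sqr ?nnegrE ?sqrtr_ge0 //; last first.
    by rewrite divr_ge0 // ltW.
  by rewrite ler_pdivrMr // mulrC.
move=> nu [nu01 nuE] A coneA.
have run := resisting_run hL hrad nu01 A nuE.
have [xs_min xsE] := hard_minimizerP N L rad nu01.
have out := resisting_output hL hrad nu01 nuE coneA.
do 6 eexists; exists (hard_minimizer N rad nu); split; [exact: run|exact: xs_min|].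
by rewrite out xsE sub0r opprK.
Qed.
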